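(* Let $M=U\Sigma V^\top\in\mathbb R^{m\times n}$ have rank $r$ (compact SVD), and let $S\in\mathbb R^{m\times s}$, $P\in\mathbb R^{n\times c}$ be selection matrices such that $\operatorname{rank}(S^\top U)=r$ and $\operatorname{rank}(V^\top P)=r$. Let $\Phi_r(A)=AP\,(S^\top A P)_r^\dagger\, S^\top A$. Suppose that $E\in\mathbb R^{m\times n}$ satisfies $S^\top E=0$ and $EP=0$. Then $$\Phi_r(M+E)-M=O(\|E\|^2).$$ Here $\|\cdot\|$ is any fixed norm on $\mathbb R^{m\times n}$, and the statement means that there are $C,\delta>0$ depending only on $M,S,P,r$ and the norm such that $\|\Phi_r(M+E)-M\|\le C\|E\|^2$ for all such $E$ with $\|E\|\le\delta$.
   Context: Compact SVD: $M=U\Sigma V^\top$ with $U\in\mathbb R^{m\times r}$, $V\in\mathbb R^{n\times r}$, $U^\top U=V^\top V=I_r$, $\Sigma=\operatorname{diag}(\sigma_1,\dots,\sigma_r)$, $\sigma_1\ge\cdots\ge\sigma_r>0$, $r\ge1$. Selection matrices: the columns of $S\in\mathbb R^{m\times s}$ and $P\in\mathbb R^{n\times c}$ are distinct columns of $I_m$ and $I_n$ respectively, so $S^\top S=I_s$, $P^\top P=I_c$. $X^\dagger$ is the Moore–Penrose pseudoinverse. $X_r$ denotes the best rank-$r$ approximation of $X$ obtained by truncating the SVD (unique when $\sigma_r(X)>\sigma_{r+1}(X)$, which holds for $X=S^\top(M+E)P$ with $E$ small; otherwise any choice). $(S^\top AP)_r^\dagger$ means the pseudoinverse of $(S^\top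 AP)_r$. *)

(* Defs.v *)
From mathcomp Require Import all_boot all_order all_algebra.
From mathcomp Require Import all_classical all_reals all_analysis.
From mathcomp Require Import ring.

Set Implicit Arguments.
Unset Strict Implicit.
Unset Printing Implicit Defensive.

Import Order.TTheory GRing.Theory Num.Def Num.Theory.
Import numFieldNormedType.Exports.

Local Open Scope classical_set_scope.
Local Open Scope ring_scope.

Definition compact_svd (R : realType) (m n k : nat) (X : 'M[R]_(m, n))
    (U : 'M[R]_(m, k)) (sigma : 'rV[R]_k) (V : 'M[R]_(n, k)) : Prop :=
  [/\ U^T *m U = 1%:M,
      V^T *m V = 1%:M,
      forall i, 0 < sigma 0 i,
      forall i j : 'I_k, (i <= j)%N -> sigma 0 j <= sigma 0 i
    & X = U *m diag_mx sigma *m V^T].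

Definition is_selection (R : realType) (m s : nat) (S : 'M[R]_(m, s)) : Prop :=
  exists2 f : 'I_s -> 'I_m, injective f & S = colsub f 1%:M.

Definition is_mx_norm (R : realType) (m n : nat) (N : 'M[R]_(m, n) -> R) :
    Prop :=
  [/\ forall X Y, N (X + Y) <= N X + N Y,
      forall a X, N (a *: X) = `|a| * N X
    & forall X, N X = 0 -> X = 0].

Definition penrose (R : realType) (m n : nat) (X : 'M[R]_(m, n))
    (G : 'M[R]_(n, m)) : Prop :=
  [/\ X *m G *m X = X,
      G *m X *m G = G,
      (X *m G)^T = X *m G
    & (G *m X)^T = G *m X].

(* The default value 0 is never used, see pinvP below. *)
Definition pinv (R : realType) (m n : nat) (X : 'M[R]_(m, n)) : 'M[R]_(n, m) :=
  xget 0 [set G | penrose X G].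

Definition truncate_sv (R : realType) (k r : nat) (sigma : 'rV[R]_k) :
    'rV[R]_k :=
  \row_i (if (i < r)%N then sigma 0 i else 0).

(* All possible values of X_r. It is a singleton unless there is a tie
   sigma_r(X) = sigma_{r+1}(X) > 0, when it depends on the SVD of X.
   If \rank X <= r, nothing is cut off and X_r = X. *)
Definition svd_truncation (R : realType) (m n r : nat) (X : 'M[R]_(m, n)) :
    set 'M[R]_(m, n) :=
  [set Y | exists (k : nat) (U : 'M[R]_(m, k)) (sigma : 'rV[R]_k)
      (V : 'M[R]_(n, k)),
    compact_svd X U sigma V /\
    Y = U *m diag_mx (truncate_sv r sigma) *m V^T].

(* All possible values of Phi_r(A), one for each choice of (S^T A P)_r. *)
Definition Phi (R : realType) (m n s c r : nat) (S : 'M[R]_(m, s))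
    (P : 'M[R]_(n, c)) (A : 'M[R]_(m, n)) : set 'M[R]_(m, n) :=
  [set A *m P *m pinv Y *m S^T *m A | Y in svd_truncation r (S^T *m A *m P)].

(* Existence of the SVD and of the pseudoinverse: Phi is never empty, and pinv
   is the Moore-Penrose pseudoinverse. *)

Section Existence.
Variable R : realType.

Let mx11 (B : 'M[R]_1) : B = (B 0 0)%:M.
Proof. exact: mx11_scalar. Qed.

Let dot m (x y : 'rV[R]_m) : R := (x *m y^T) 0 0.

Let dotE m (x y : 'rV[R]_m) : dot x y = \sum_i x 0 i * y 0 i.
Proof. by rewrite /dot mxE; apply: eq_bigr => i _; rewrite mxE. Qed.

Let dot_ge0 m (x : 'rV[R]_m) : 0 <= dot x x.
Proof. by rewrite dotE sumr_ge0 // => i _; rewrite -expr2 sqr_ge0. Qed.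

Let dot_eq0 m (x : 'rV[R]_m) : dot x x = 0 -> x = 0.
Proof.
rewrite dotE => /eqP; rewrite psumr_eq0; last first.
  by move=> i _; rewrite -expr2 sqr_ge0.
move=> /allP h; apply/rowP => i; rewrite mxE; apply/eqP.
by have := h i (mem_index_enum i); rewrite -expr2 sqrf_eq0.
Qed.

Let dotZ m (a : R) (x : 'rV[R]_m) : dot (a *: x) (a *: x) = a ^+ 2 * dot x x.
Proof.
by rewrite !dotE mulr_sumr; apply: eq_bigr => i _; rewrite !mxE mulrACA expr2.
Qed.

Let dotD m (x y : 'rV[R]_m) t :
  dot (x + t *: y) (x + t *: y) = dot x x + 2 * t * dot x y + t ^+ 2 * dot y y.
Proof.
rewrite !dotE !mulr_sumr -!big_split /=; apply: eq_bigr => i _.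
by rewrite !mxE; ring.
Qed.

Let continuous_dot m n (A : 'M[R]_(m, n)) :
  continuous (fun x : 'rV[R]_m => dot (x *m A) (x *m A)).
Proof.
have cA j : continuous (fun x : 'rV[R]_m => (x *m A) 0 j).
  rewrite (_ : (fun x => _) = (fun x : 'rV[R]_m => \sum_i x 0 i * A i j));
    last by apply/funext => x; rewrite mxE.
  apply: continuous_big => [|i _ x]; first exact: add_continuous.
  by apply: continuousM; [exact: coord_continuous|exact: cst_continuous].
rewrite (_ : (fun x => _) =
    (fun x : 'rV[R]_m => \sum_j (x *m A) 0 j * (x *m A) 0 j)); last first.
  by apply/funext => x; rewrite dotE.
apply: continuous_big => [|i _ x]; first exact: add_continuous.
by apply: continuousM; exact: cA.
Qed.

Let compact_sphere m : compact [set x : 'rV[R]_m | dot x x = 1].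
Proof.
apply: bounded_closed_compact.
  exists 1; split; first exact: num_real.
  move=> M M1 x /= x1; rewrite [leLHS]/normr /= mx_normrE.
  apply/bigmax_leP; split => [|[i j] _ /=]; first by rewrite (le_trans _ (ltW M1)).
  rewrite (le_trans _ (ltW M1)) // -(@ler_pXn2r _ 2) ?nnegrE //.
  rewrite expr1n real_normK ?num_real // -x1 dotE (bigD1 j) //= ord1 expr2.
  by rewrite lerDl sumr_ge0 // => k _; rewrite -expr2 sqr_ge0.
rewrite (_ : mkset _ = (fun x => dot (x *m 1%:M) (x *m 1%:M)) @^-1` [set 1]).
  apply: preimage_closed; last exact: closed_eq.
  by move=> x _; exact: continuous_dot.
by apply/seteqP; split => x /=; rewrite mulmx1.
Qed.

Let top_singular m n (A : 'M[R]_(m, n)) : A != 0 ->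
  exists (u : 'rV[R]_m) (v : 'rV[R]_n) (t : R),
    [/\ 0 < t, u *m u^T = 1%:M, v *m v^T = 1%:M,
        u *m A = t *: v /\ v *m A^T = t *: u
      & forall x, dot (x *m A) (x *m A) <= t ^+ 2 * dot x x].
Proof.
move=> A0; pose f x := dot (x *m A) (x *m A).
have [i0 Ai0] : exists i, row i A != 0.
  apply/existsP; apply: contra_neqT A0; rewrite negb_exists => /forallP h.
  by apply/row_matrixP => i; rewrite row0; apply/eqP; have := h i; rewrite negbK.
pose e : 'rV[R]_m := delta_mx 0 i0.
have e1 : dot e e = 1.
  by rewrite /dot /e trmx_delta mul_delta_mx mxE !eqxx.
have [u uS umax] : exists2 u, u \in [set x : 'rV[R]_m | dot x x = 1] &
    forall x, x \in [set x : 'rV[R]_m | dot x x = 1] -> f x <= f u.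
  apply: EVT_max_rV; first by exists e.
    exact: compact_sphere.
  by apply: continuous_subspaceT; exact: continuous_dot.
rewrite inE /= in uS.
have fmax x : f x <= f u * dot x x.
  have [x0|x0] := eqVneq (dot x x) 0.
    by rewrite x0 mulr0 /f (dot_eq0 x0) mul0mx /dot mul0mx mxE.
  have xp : 0 < dot x x by rewrite lt_def x0 dot_ge0.
  pose a := (Num.sqrt (dot x x))^-1.
  have a2 : a ^+ 2 = (dot x x)^-1 by rewrite /a exprVn sqr_sqrtr ?ltW.
  have := umax (a *: x); rewrite inE /= dotZ a2 mulVf // => /(_ erefl).
  by rewrite /f -scalemxAl dotZ a2 mulrC ler_pdivrMr.
have fu0 : 0 < f u.
  apply: lt_le_trans (umax e _); last by rewrite inE.
  rewrite /f -rowE lt_def dot_ge0 andbT.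
  by apply: contra_neq Ai0 => /dot_eq0.
pose t := Num.sqrt (f u).
have t0 : 0 < t by rewrite sqrtr_gt0.
have t2 : t ^+ 2 = f u by rewrite sqr_sqrtr // ltW.
pose y : 'rV[R]_m := u *m A *m A^T - t ^+ 2 *: u.
have y0 : y = 0.
  apply: dot_eq0; set d := dot y y.
  pose g := t ^+ 2 * dot y y - f y.
  have g0 : 0 <= g by rewrite subr_ge0 t2; exact: fmax.
  have dE : d = dot (u *m A) (y *m A) - t ^+ 2 * dot u y.
    have yy : y *m y^T = u *m A *m (y *m A)^T - t ^+ 2 *: (u *m y^T).
      by rewrite {1}/y mulmxBl trmx_mul -scalemxAl !mulmxA.
    have e00 (B C : 'M[R]_1) z : (B - z *: C) 0 0 = B 0 0 - z * C 0 0.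
      by rewrite !mxE.
    by rewrite /d /dot yy e00.
  have H z : 0 <= z ^+ 2 * g - 2 * z * d.
    have := fmax (u + z *: y); rewrite -subr_ge0.
    rewrite -t2 /f mulmxDl -scalemxAl !dotD uS.
    have -> : dot (u *m A) (u *m A) = t ^+ 2 by rewrite t2.
    by rewrite dE /g /f; congr (_ <= _); ring.
  have d0 : 0 <= d by exact: dot_ge0.
  have g1 : 0 < g + 1 by rewrite ltr_wpDl.
  have := H (d / (g + 1)).
  have -> : (d / (g + 1)) ^+ 2 * g - 2 * (d / (g + 1)) * d =
    - (d ^+ 2 * (g + 2) / (g + 1) ^+ 2) by field; rewrite gt_eqF.
  rewrite oppr_ge0 pmulr_lle0 ?invr_gt0 ?exprn_gt0 //.
  rewrite pmulr_lle0 ?ltr_wpDl // => d2.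
  by apply/eqP; rewrite -sqrf_eq0 eq_le d2 sqr_ge0.
have uAA : u *m A *m A^T = t ^+ 2 *: u by apply/eqP; rewrite -subr_eq0 -/y y0.
exists u, (t^-1 *: (u *m A)), t; split => //.
- by rewrite [LHS]mx11 -/(dot u u) uS.
- rewrite [LHS]mx11 -/(dot (t^-1 *: (u *m A)) (t^-1 *: (u *m A))) dotZ.
  by rewrite -/(f u) -t2 -exprMn mulVf ?expr1n // gt_eqF.
- split; first by rewrite scalerA mulfV ?scale1r // gt_eqF.
  by rewrite -scalemxAl uAA scalerA expr2 mulKf // gt_eqF.
- by move=> x; rewrite t2; exact: fmax.
Qed.

Lemma compact_svd_exists m n (X : 'M[R]_(m, n)) :
  exists (k : nat) (U : 'M[R]_(m, k)) (sigma : 'rV[R]_k) (V : 'M[R]_(n, k)),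
    compact_svd X U sigma V.
Proof.
have [p] := ubnP (\rank X); elim: p X => // p IH X; rewrite ltnS => rX.
have [->|X0] := eqVneq X 0.
  exists 0%N, 0, 0, 0; split; try by [case|apply/matrixP; case].
  by rewrite !mul0mx.
have [u [v [t [t0 uu vv [uX vX] tmax]]]] := top_singular X0.
pose Y := X - t *: (u^T *m v).
have uY : u *m Y = 0.
  by rewrite /Y mulmxBr uX -scalemxAr mulmxA uu mul1mx subrr.
have vY : Y *m v^T = 0.
  rewrite /Y mulmxBl -scalemxAl -mulmxA vv mulmx1.
  by rewrite -[X]trmxK -trmx_mul vX linearZ /= subrr.
have rY : (\rank Y < p)%N.
  apply: leq_trans rX; apply: rank_ltmx; apply/andP; split.
    have -> : Y = (1%:M - u^T *m u) *m X.
      by rewrite mulmxBl mul1mx -mulmxA uX -scalemxAr.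
    exact: submxMl.
  have vsX : (v <= X)%MS.
    rewrite -[v]scale1r -[1](@mulVf _ t) ?gt_eqF // -scalerA -uX.
    by rewrite scalemx_sub // submxMl.
  apply/negP => /(submx_trans vsX) /submxP[w wE].
  have : v *m v^T = 0 by rewrite {1}wE -mulmxA vY mulmx0.
  rewrite vv => /matrixP/(_ 0 0); rewrite !mxE eqxx => /eqP.
  by rewrite oner_eq0.
have [k [U [sg [V [UU VV sg0 sgm YE]]]]] := IH _ rY.
have Dinj j (B : 'M[R]_(j, k)) : B *m diag_mx sg = 0 -> B = 0.
  move=> /matrixP h; apply/matrixP => a b; have := h a b.
  rewrite mul_mx_diag !mxE => /eqP; rewrite mulf_eq0 => /orP[/eqP //|].
  by rewrite gt_eqF.
have uU : u *m U = 0.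
  apply: Dinj; have := congr1 (mulmx^~ V) uY.
  by rewrite YE mul0mx -!mulmxA VV mulmx1 !mulmxA.
have vV : v *m V = 0.
  apply: Dinj; have := congr1 (mulmx^~ U) (congr1 trmx vY).
  rewrite YE trmx_mul !trmxK trmx0 mul0mx !trmx_mul trmxK tr_diag_mx.
  by rewrite -!mulmxA UU mulmx1.
have sgt i : sg 0 i <= t.
  have := tmax (row i U^T).
  have XE : X = Y + t *: (u^T *m v) by rewrite subrK.
  have Uu : U^T *m u^T = 0 by rewrite -trmx_mul uU trmx0.
  have -> : row i U^T *m X = sg 0 i *: row i V^T.
    rewrite -row_mul XE mulmxDr -scalemxAr mulmxA Uu mul0mx scaler0 addr0.
    rewrite YE !mulmxA UU mul1mx mul_diag_mx.
    by apply/rowP => l; rewrite !mxE.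
  rewrite dotZ /dot.
  have one j (W : 'M[R]_(j, k)) : W^T *m W = 1%:M ->
      (row i W^T *m (row i W^T)^T) 0 0 = 1.
    move=> WW; have := congr1 (fun B : 'M[R]_k => B i i) WW.
    rewrite !mxE eqxx mulr1n => <-; apply: eq_bigr => l _.
    by rewrite !mxE.
  rewrite !one // !mulr1 => sg_le.
  by rewrite -(@ler_pXn2r _ 2) ?nnegrE // ltW.
exists (1 + k)%N, (row_mx u^T U), (row_mx t%:M sg), (row_mx v^T V); split.
- rewrite tr_row_mx mul_col_row trmxK uu UU uU -trmx_mul uU trmx0.
  by rewrite -scalar_mx_block.
- rewrite tr_row_mx mul_col_row trmxK vv VV vV -trmx_mul vV trmx0.
  by rewrite -scalar_mx_block.
- by move=> i; rewrite mxE; case: splitP => l _ //; rewrite ord1 mxE eqxx.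
- move=> i j; rewrite !mxE.
  case: splitP => a ja; case: splitP => b ib; rewrite ?ord1 ?mxE ?eqxx //=.
    by rewrite ja ib ord1.
  by rewrite ja ib leq_add2l; exact: sgm.
- rewrite diag_mx_row mul_row_block tr_row_mx !mulmx0 addr0 add0r mul_row_col.
  rewrite -YE (_ : diag_mx _ = t%:M); last first.
    by apply/matrixP => a b; rewrite !mxE !ord1 eqxx.
  by rewrite mul_mx_scalar -scalemxAl trmxK /Y [RHS]addrC subrK.
Qed.

Lemma penrose_exists m n (X : 'M[R]_(m, n)) : exists G, penrose X G.
Proof.
have [k [U [sg [V [UU VV sg0 _ ->]]]]] := compact_svd_exists X.
pose D := diag_mx sg; pose D' := diag_mx (\row_i (sg 0 i)^-1).
have DD' : D *m D' = 1%:M.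
  rewrite /D /D' mulmx_diag; apply/matrixP => i j; rewrite !mxE.
  by rewrite mulfV ?lt0r_neq0.
have D'D : D' *m D = 1%:M by rewrite [LHS]diag_mxC.
have UE l (B : 'M[R]_(k, l)) : U^T *m (U *m B) = B by rewrite mulmxA UU mul1mx.
have VE l (B : 'M[R]_(k, l)) : V^T *m (V *m B) = B by rewrite mulmxA VV mul1mx.
have DE l (B : 'M[R]_(k, l)) : D *m (D' *m B) = B by rewrite mulmxA DD' mul1mx.
have D'E l (B : 'M[R]_(k, l)) : D' *m (D *m B) = B by rewrite mulmxA D'D mul1mx.
exists (V *m D' *m U^T); rewrite /penrose -/D -!mulmxA.
by rewrite !(UE, VE, DE, D'E) !trmx_mul !trmxK.
Qed.

Lemma penrose_unique m n (X : 'M[R]_(m, n)) G H :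
  penrose X G -> penrose X H -> G = H.
Proof.
move=> [g1 g2 g3 g4] [h1 h2 h3 h4].
have GH : X *m G = X *m H.
  rewrite -g3 -{1}h1 -[X *m H *m X *m G]mulmxA trmx_mul g3 h3.
  by rewrite mulmxA g1.
have HG : G *m X = H *m X.
  rewrite -g4 -{1}h1 -[X *m H *m X]mulmxA mulmxA trmx_mul g4 h4.
  by rewrite -mulmxA [X *m (G *m X)]mulmxA g1.
by rewrite -g2 -mulmxA GH mulmxA HG h2.
Qed.

Lemma pinvP m n (X : 'M[R]_(m, n)) : penrose X (pinv X).
Proof.
have [G XG] := penrose_exists X.
exact: (@xgetPex _ 0 [set G | penrose X G] (ex_intro _ G XG)).
Qed.

Lemma svd_truncation_nonempty m n r (X : 'M[R]_(m, n)) :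
  svd_truncation r X !=set0.
Proof.
have [k [U [sg [V XE]]]] := compact_svd_exists X.
by exists (U *m diag_mx (truncate_sv r sg) *m V^T), k, U, sg, V.
Qed.

Lemma Phi_nonempty m n s c r (S : 'M[R]_(m, s)) (P : 'M[R]_(n, c)) A :
  Phi r S P A !=set0.
Proof. exact/image_nonempty/svd_truncation_nonempty. Qed.

End Existence.

(* Main.v *)
(* Since E P = 0 and S^T E = 0, the three factors of Phi_r(M + E) do not see E:
   they are M P, X = S^T M P and S^T M. As X has rank at most r, truncation does
   nothing to it, and M P X^+ S^T M = M because S^T U is left invertible and
   V^T P is right invertible. Hence Phi_r(M + E) = M exactly. *)
Require Import Defs.
From mathcomp Require Import all_boot all_order all_algebra.
From mathcomp Require Import all_classical all_reals all_analysis.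

Set Implicit Arguments.
Unset Strict Implicit.
Unset Printing Implicit Defensive.

Import Order.TTheory GRing.Theory Num.Theory.
Import numFieldNormedType.Exports.

Local Open Scope classical_set_scope.
Local Open Scope ring_scope.

(** Orthonormality gives [diag_mx sigma = U^T *m X *m V]; this diagonal matrix has positive entries,
    so its rank is [k], and a product has rank at most that of [X]. *)
Lemma compact_svd_leq_rank (R : realType) (m n k : nat) (X : 'M[R]_(m, n))
    (U : 'M[R]_(m, k)) (sigma : 'rV[R]_k) (V : 'M[R]_(n, k)) :
  compact_svd X U sigma V -> (k <= \rank X)%N.
Proof.
move=> [UU VV sigma0 _ XE].
have DE : diag_mx sigma = U^T *m X *m V.
  by rewrite XE !mulmxA UU mul1mx -mulmxA VV mulmx1.
have D_unit : diag_mx sigma \in unitmx.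
  rewrite unitmxE det_diag unitfE; apply/prodf_neq0 => i _.
  by rewrite gt_eqF.
rewrite -{1}(mxrank_unit D_unit) DE.
by apply: leq_trans (mxrankM_maxl _ _) _; exact: mxrankM_maxr.
Qed.

(** Whichever SVD is chosen, it has at most [r] singular values, so truncation zeroes none of
    them. *)
Lemma svd_truncation_id (R : realType) (m n r : nat) (X Y : 'M[R]_(m, n)) :
  (\rank X <= r)%N -> svd_truncation r X Y -> Y = X.
Proof.
move=> rX [k [U [sigma [V [svdX ->]]]]].
have kr : (k <= r)%N := leq_trans (compact_svd_leq_rank svdX) rX.
have -> : truncate_sv r sigma = sigma.
  by apply/rowP => i; rewrite mxE (leq_trans (ltn_ord i) kr).
by case: svdX.
Qed.

(** A left inverse [L] of [S *m U] and a right inverse [Q] of [W *m P] recover [M *m P] and [S *m M]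
    from the core [X]; then [X *m G *m X = X] absorbs [G]. *)
Lemma cross_approximation_exact (R : realType) (m n r s c : nat)
    (U : 'M[R]_(m, r)) (D : 'M[R]_r) (W : 'M[R]_(r, n))
    (S : 'M[R]_(s, m)) (P : 'M[R]_(n, c)) (G : 'M[R]_(c, s)) :
  let M := U *m D *m W in
  let X := S *m M *m P in
  row_full (S *m U) -> row_free (W *m P) -> X *m G *m X = X ->
  M *m P *m G *m S *m M = M.
Proof.
move=> M X /row_fullP[L LSU] /row_freeP[Q WPQ] XGX.
have ULSU : U *m L *m S *m U = U by rewrite -!mulmxA LSU mulmx1.
have WPQW : W *m (P *m (Q *m W)) = W by rewrite !mulmxA WPQ mul1mx.
have MP : M *m P = U *m L *m X by rewrite /X /M !mulmxA ULSU.
have SM : S *m M = X *m Q *m W by rewrite /X /M -!mulmxA WPQW.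
rewrite -mulmxA SM MP.
have -> : U *m L *m X *m G *m (X *m Q *m W) =
    U *m L *m (X *m G *m X) *m Q *m W by rewrite !mulmxA.
by rewrite XGX -MP /M -!mulmxA WPQW.
Qed.

Theorem corollary3p3 (R : realType) (m n r s c : nat) (r_gt0 : (0 < r)%N)
    (M : 'M[R]_(m, n))
    (U : 'M[R]_(m, r)) (sigma : 'rV[R]_r) (V : 'M[R]_(n, r))
    (svdM : compact_svd M U sigma V)
    (S : 'M[R]_(m, s)) (P : 'M[R]_(n, c))
    (selS : is_selection S) (selP : is_selection P)
    (rankSU : \rank (S^T *m U) = r) (rankVP : \rank (V^T *m P) = r)
    (N : 'M[R]_(m, n) -> R) (normN : is_mx_norm N) :
  exists C delta : R,
    [/\ 0 < C,
        0 < delta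
      & forall E : 'M[R]_(m, n), S^T *m E = 0 -> E *m P = 0 ->
        N E <= delta ->
        forall B : 'M[R]_(m, n), Phi r S P (M + E) B ->
          N (B - M) <= C * N E ^+ 2].
Proof.
(* Any positive constants do, since the error [B - M] turns out to be zero. *)
exists 1, 1; split; rewrite ?ltr01 // => E SE EP _ B [Y].
rewrite mulmxDr SE addr0 => YX <-.
have ME : M = U *m diag_mx sigma *m V^T by case: svdM.
(* The product ends in the factor [V^T *m P], whose rank is [r]. *)
have rankX : (\rank (S^T *m M *m P) <= r)%N.
  rewrite ME -!mulmxA -[leqRHS]rankVP !mulmxA -[_ *m V^T *m P]mulmxA.
  exact: mxrankM_maxr.
have -> : (M + E) *m P *m Defs.pinv Y *m S^T *m (M + E) = M.
  rewrite (svd_truncation_id rankX YX).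
  rewrite mulmxDl EP addr0 mulmxDr -[_ *m E]mulmxA SE mulmx0 addr0.
  have [XGX _ _ _] := Defs.pinvP (S^T *m M *m P).
  (* The pseudoinverse is generalized to [G], keeping the first Penrose equation. *)
  move: (Defs.pinv _) XGX => G; rewrite ME; apply: cross_approximation_exact.
    by rewrite /row_full rankSU.
  by rewrite /row_free rankVP.
have [_ NZ _] := normN.
have N0 : N 0 = 0 by rewrite -(scale0r 0) NZ normr0 mul0r.
by rewrite subrr N0 mul1r sqr_ge0.
Qed.
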